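(* Let $X$ be a real locally convex Hausdorff topological vector space with topological dual $Y=X^\prime$, and let $C\subseteq X$ be a proper pointed cone (i.e. $C\neq X$). Then the following are equivalent: (i) $C\cup(-C)=X$; (ii) $H\cap K\neq\emptyset$ for all $H,K\in\mathscr{K}(C)$; (iii) there exists a family $\mathscr{K}\subseteq\mathcal{P}(Y)$ representing $C$ such that $H\cap K\neq\emptyset$ for all $H,K\in\mathscr{K}$.
   Context: Write $\langle x,y\rangle:=y(x)$ for $x\in X$, $y\in Y=X^\prime$. A nonempty subset $C\subseteq X$ is a cone if $\lambda C\subseteq C$ for all real $\lambda>0$; it is pointed if $0\in C$. Given a nonempty family $\mathscr{K}\subseteq\mathcal{P}(Y)$ of nonempty sets, a cone $C\subseteq X$ is represented by $\mathscr{K}$ (equivalently, $\mathscr{K}$ represents $C$) if $C=C_{\mathscr{K}}$, where $$C_{\mathscr{K}}:=\{x\in X:\ \forall K\in\mathscr{K},\ \exists y\in K,\ \langle x,y\rangle\ge 0\}.$$ For $x\in X$ let $G_x:=\{y\in Y:\langle x,y\rangle<0\}$, and for a pointed cone $C$ let $\mathscr{K}(C):=\{G_x: x\in X\setminus C\}$. *)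

(* Defs.v *)
From mathcomp Require Import all_boot all_order all_algebra.
From mathcomp Require Import all_classical all_reals all_analysis.

Set Implicit Arguments.
Unset Strict Implicit.
Unset Printing Implicit Defensive.

Import Order.TTheory GRing.Theory Num.Theory.
Import numFieldNormedType.Exports.

Local Open Scope classical_set_scope.
Local Open Scope ring_scope.

Record topological_dual (R : realType) (X : tvsType R) : Type := TopologicalDual {
  dual_fun :> {scalar X};
  dual_continuous : continuous (dual_fun : X -> R) }.

Definition pairing (R : realType) (X : tvsType R) (x : X) (y : topological_dual X) : R :=
  y x.

Section cones.
Context (R : realType) (X : tvsType R).
Implicit Types (C : set X) (F : set (set (topological_dual X))).

Definition cone C : Prop :=
  C !=set0 /\ forall (l : R) (x : X), 0 < l -> C x -> C (l *: x).

Definition pointed_cone C : Prop := cone C /\ C 0.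

Definition cone_of F : set X :=
  [set x | forall K, F K -> exists y, K y /\ 0 <= pairing x y].

Definition represents F C : Prop :=
  [/\ F !=set0, (forall K, F K -> K !=set0) & C = cone_of F].

Definition neg_halfspace (x : X) : set (topological_dual X) := [set y | pairing x y < 0].

Definition canonical_family C : set (set (topological_dual X)) :=
  [set neg_halfspace x | x in ~` C].

Definition pairwise_meeting F : Prop :=
  forall H K, F H -> F K -> H `&` K !=set0.

End cones.

(* Main.v *)
Require Import Defs.
From HB Require Import structures.
From mathcomp Require Import all_boot all_order all_algebra.
From mathcomp Require Import all_classical all_reals all_analysis.
From mathcomp Require Import ring lra.

Import Order.TTheory GRing.Theory Num.Theory.
Import numFieldNormedType.Exports.

Local Open Scope classical_set_scope.
Local Open Scope ring_scope.

(** The implications use two facts about the dual of [X].  First, two vectors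
    [u] and [v] are made negative by one continuous functional as soon as [v]
    is nonzero and [u] is not a nonnegative multiple of [- v]
    ([exists_dual_lt0_pair]).  If [u] lies outside the pointed cone [C] while
    [- v] lies in [C], the second condition is automatic, because [C] contains
    the nonnegative multiples of [- v] ([exists_dual_lt0_cone_pair]).

    - From [C `|` - C = X] to meeting half-spaces: for [u], [v] outside [C],
      the vector [- v] is in [C], so the functional above lies in both
      half-spaces.
    - From meeting half-spaces to a representing family: the canonical family
      represents every proper pointed cone.  For nonzero [x] in [C] and [z] outside
      it, the pair [z], [- x] yields a functional in the half-space of [z] that is
      nonnegative at [x]; conversely, if [x] is outside [C], no element of its
      own half-space is nonnegative at [x].
    - From a representing family to [C `|` - C = X]: if [x] and [- x] were both
      outside [C], some member of the family would be negative at [x] and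
      another at [- x], and no functional is negative at both.

    The second fact is that continuous functionals separate points
    ([exists_dual_eqN1]).  It comes from the Hahn-Banach theorem
    ([hahn_banach]) applied to the gauge of a convex neighbourhood of [0].  The
    proof of Hahn-Banach avoids extending partial functionals: among the
    sublinear functions below [p], Zorn's lemma provides a minimal one, and a
    minimal sublinear function is linear.  The sublinear functions that occur
    (the gauge, the infimum of a chain, and the perturbation that proves
    linearity) are all lower envelopes of convex cones in [X * R]
    ([sublinear_inf]). *)

(** * Sublinear functions and the Hahn-Banach theorem *)

Section hahn_banach.
Context {R : realType} {X : lmodType R}.
Implicit Types (p q : X -> R) (E : X -> set R) (x y z : X) (r s t l : R).

(** An inequality suffices for homogeneity: replacing [l] by its inverse gives
    the reverse one. *)
Definition sublinear q : Prop :=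
  (forall x y, q (x + y) <= q x + q y) /\
  (forall l x, 0 < l -> q (l *: x) <= l * q x).

Lemma sublinearZ {q} : sublinear q -> forall l x, 0 < l -> q (l *: x) = l * q x.
Proof.
move=> [_ qZ] l x l0; apply/eqP; rewrite eq_le qZ//= -ler_pdivlMl//.
have li0 : 0 < l^-1 by rewrite invr_gt0.
by have := qZ _ (l *: x) li0; rewrite scalerA mulVf ?gt_eqF// scale1r.
Qed.

Lemma sublinear0 {q} : sublinear q -> q 0 = 0.
Proof.
by move=> qs; have := sublinearZ qs 2 0 (ltr0Sn _ 1); rewrite scaler0; lra.
Qed.

(** [E x] is the fibre above [x] of a convex cone in [X * R].  The condition on
    [E 0] says that the cone contains no vertical half-line going down; it
    is what makes the infimum of each fibre finite. *)
Definition epigraph_cone E : Prop :=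
  [/\ forall x, E x !=set0,
      forall r, E 0 r -> 0 <= r,
      forall x y r s, E x r -> E y s -> E (x + y) (r + s)
    & forall l x r, 0 < l -> E x r -> E (l *: x) (l * r)].

(** If [s] is in the fibre above [- x], adding it to any [r] in the fibre above
    [x] lands in the fibre above [0], hence [- s <= r]. *)
Lemma epigraph_cone_has_lbound {E} : epigraph_cone E ->
  forall x, has_lbound (E x).
Proof.
move=> [E0 Ege0 ED _] x; have [s Es] := E0 (- x).
exists (- s) => r Er; have /Ege0 : E 0 (r + s) by rewrite -(subrr x); exact: ED.
lra.
Qed.

Lemma sublinear_inf {E} : epigraph_cone E -> sublinear (fun x => inf (E x)).
Proof.
move=> Ec; have lbE := epigraph_cone_has_lbound Ec; have [E0 _ ED EZ] := Ec.
split=> [x y|l x l0].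
- rewrite -lerBlDr; apply: lb_le_inf => // r Er.
  rewrite lerBlDr -lerBlDl; apply: lb_le_inf => // s Es.
  rewrite lerBlDl; apply: ge_inf => //; exact: ED.
- rewrite -ler_pdivrMl//; apply: lb_le_inf => // r Er.
  rewrite ler_pdivrMl//; apply: ge_inf => //; exact: EZ.
Qed.

(** The lower envelope of these fibres is the infimum over [t >= 0] of
    [q (x + t *: y) - t * q y]: it lowers [q] so as to become linear along
    [y]. *)
Definition tilt_epigraph q y : X -> set R :=
  fun x => [set r | exists2 t, 0 <= t & q (x + t *: y) - t * q y <= r].

Lemma tilt_epigraph_cone {q} y : sublinear q ->
  epigraph_cone (tilt_epigraph q y).
Proof.
move=> qs; split.
- by move=> x; exists (q x), 0; rewrite // scale0r mul0r addr0 subr0.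
- move=> r [t t0]; rewrite add0r; apply: le_trans; rewrite subr_ge0.
  move: t0; rewrite le_eqVlt => /predU1P[<-|t0].
    by rewrite scale0r mul0r (sublinear0 qs).
  by rewrite (sublinearZ qs).
- move=> x x' r s [t t0 rt] [t' t'0 st']; exists (t + t'); first exact: addr_ge0.
  rewrite scalerDl addrACA mulrDl.
  have := qs.1 (x + t *: y) (x' + t' *: y); lra.
- move=> l x r l0 [t t0 rt]; exists (l * t); first by rewrite mulr_ge0// ltW.
  by rewrite -scalerA -scalerDr (sublinearZ qs)// -mulrA -mulrBr ler_pM2l.
Qed.

(** The values [t = 0] and [t = 1] in the infimum give the two bounds.  At
    [x = - y] the second one reads [q' (- y) <= - q y]. *)
Lemma exists_sublinear_tilt {q} y : sublinear q ->
  exists q', [/\ sublinear q', forall x, q' x <= q x &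
    forall x, q' x <= q (x + y) - q y].
Proof.
move=> qs; have Ec := tilt_epigraph_cone y qs.
have lbE := epigraph_cone_has_lbound Ec.
exists (fun x => inf (tilt_epigraph q y x)); split=> [|x|x].
- exact: sublinear_inf.
- apply: ge_inf => //; exists 0 => //.
  by rewrite scale0r mul0r addr0 subr0.
- apply: ge_inf => //; exists 1 => //.
  by rewrite scale1r mul1r.
Qed.

(** Zorn's lemma applies since the pointwise infimum of a nonempty chain is
    again sublinear: of two members of the chain the smaller one bounds the sum
    of their values at [x] and [y], and all members vanish at [0]. *)
Lemma exists_minimal_sublinear {p} : sublinear p ->
  exists q, [/\ sublinear q, forall x, q x <= p x &
    forall q', sublinear q' -> (forall x, q' x <= q x) -> q' = q].
Proof.
move=> ps; pose P q := sublinear q /\ forall x, q x <= p x; pose T := {q | P q}.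
have Tp : P p by [].
pose below (q q' : T) := `[< forall x, sval q' x <= sval q x >].
have [||A Atot|[q [qs qp]] qmin] := @ZL_preorder T (exist P p Tp) below.
- by move=> q; apply/asboolP.
- move=> a b c /asboolP ba /asboolP cb; apply/asboolP => x.
  exact: le_trans (cb x) (ba x).
- have [A0|/nonemptyPn A0] := pselect (A !=set0); last first.
    by exists (exist P p Tp) => q; rewrite A0.
  pose E x : set R := [set r | exists2 q, A q & sval q x <= r].
  have Ec : epigraph_cone E.
    split.
    - by move=> x; have [q Aq] := A0; exists (sval q x), q.
    - by move=> r [[q [qs qp]] _] /=; rewrite (sublinear0 qs).
    - move=> x y r s [a Aa ar] [b Ab bs].
      have [ba|ab] := Atot a b Aa Ab.
      + exists b => //; apply: le_trans ((svalP b).1.1 x y) _.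
        by apply: lerD => //; apply: le_trans ar; exact: (asboolP _ ba).
      + exists a => //; apply: le_trans ((svalP a).1.1 x y) _.
        by apply: lerD => //; apply: le_trans bs; exact: (asboolP _ ab).
    - move=> l x r l0 [a Aa ar]; exists a => //.
      by apply: le_trans ((svalP a).1.2 _ _ l0) _; rewrite ler_pM2l.
  have infA (q : T) : A q -> forall x, inf (E x) <= sval q x.
    move=> Aq x; apply: ge_inf; first exact: epigraph_cone_has_lbound.
    by exists q.
  have Tinf : P (fun x => inf (E x)).
    split; first exact: sublinear_inf.
    by move=> x; have [q Aq] := A0; apply: le_trans (infA q Aq x) ((svalP q).2 x).
  by exists (exist P _ Tinf) => q Aq; apply/asboolP => x; exact: infA.
- exists q; split=> // q' q's q'q; apply/funext => x; apply/eqP.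
  rewrite eq_le q'q/=.
  have Tq' : P q'.
    by split=> // y; apply: le_trans (q'q y) (qp y).
  have /asboolP := qmin (exist P q' Tq') (asboolT q'q); exact.
Qed.

(** By minimality the tilt of [q] along any [y] is [q] itself, which yields the
    superadditivity [q x + q y <= q (x + y)]. *)
Lemma minimal_sublinear_linear {q} : sublinear q ->
    (forall q', sublinear q' -> (forall x, q' x <= q x) -> q' = q) ->
  forall l x y, q (l *: x + y) = l * q x + q y.
Proof.
move=> qs qmin.
have qD x y : q (x + y) = q x + q y.
  apply/eqP; rewrite eq_le qs.1/=.
  have [q' [q's q'q q'y]] := exists_sublinear_tilt y qs.
  by have := q'y x; rewrite (qmin q' q's q'q) lerBrDr.
have qN x : q (- x) = - q x.
  by apply/eqP; rewrite -subr_eq0 opprK -qD addNr (sublinear0 qs).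
move=> l x y; rewrite qD; congr (_ + _).
have [l0|l0|->] := ltgtP l 0.
- apply: oppr_inj; rewrite -qN -scaleNr (sublinearZ qs) ?oppr_gt0//.
  by rewrite mulNr.
- exact: sublinearZ.
- by rewrite scale0r mul0r (sublinear0 qs).
Qed.

(** Tilting [p] along [z] before minimizing forces [f (- z) <= - p z], so that
    the bound is attained at [z]. *)
Theorem hahn_banach {p} z : sublinear p ->
  exists f : {scalar X}, (forall x, f x <= p x) /\ f z = p z.
Proof.
move=> ps; have [p' [p's p'p p'z]] := exists_sublinear_tilt z ps.
have [q [qs qp' qmin]] := exists_minimal_sublinear p's.
have qlin := minimal_sublinear_linear qs qmin.
pose f : {scalar X} := HB.pack q (GRing.isLinear.Build R X R^o _ q qlin).
exists f; split=> [x|]; first exact: le_trans (qp' x) (p'p x).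
apply/eqP; rewrite eq_le (le_trans (qp' z) (p'p z))/=.
have := le_trans (qp' (- z)) (p'z (- z)).
rewrite addNr (sublinear0 ps) sub0r -[q]/(f : X -> R) linearN.
by rewrite lerN2.
Qed.

End hahn_banach.

(** * Continuous functionals on a locally convex space *)

Section point_separation.
Context {R : realType} {X : tvsType R}.
Implicit Types (U C : set X) (x u v z : X).

(** The lower envelope is the Minkowski gauge of [U]. *)
Definition gauge_epigraph U : X -> set R :=
  fun x => [set r | 0 < r /\ U (r^-1 *: x)].

(** Scalar multiplication is continuous at [0], so small multiples of [x] enter
    [U]. *)
Lemma nbhs0_absorbing {U} x : nbhs 0 U -> exists r : R, 0 < r /\ U (r^-1 *: x).
Proof.
move=> U0.
have : (fun c : R^o => c *: x) @ nbhs (0 : R^o) --> (0 : X).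
  rewrite -[X in _ --> X](scale0r x).
  by apply: (cvg_comp2 cvg_id (cvg_cst x) (@scale_continuous R X (_, _))).
move=> /(_ U U0) /nbhs_ballP[e /= e0 eU].
exists (2 / e); split; first by rewrite divr_gt0.
rewrite invf_div; apply: eU; rewrite /ball/= sub0r normrN gtr0_norm ?divr_gt0//.
by rewrite ltr_pdivrMr// ltr_pMr// ltr1n.
Qed.

Lemma gauge_epigraph_cone {U} : nbhs 0 U -> convex_set U ->
  epigraph_cone (gauge_epigraph U).
Proof.
move=> U0 cU; split.
- by move=> x; apply: nbhs0_absorbing.
- by move=> r [/ltW].
- move=> x y r s [r0 Ux] [s0 Uy]; have rs0 := addr_gt0 r0 s0.
  split=> //; have l0 : 0 <= r / (r + s) by rewrite divr_ge0 ?ltW.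
  have l1 : r / (r + s) <= 1 by rewrite ler_pdivrMr// mul1r lerDl ltW.
  (* (x + y) / (r + s) is the convex combination of x / r and y / s with
     weights r / (r + s) and s / (r + s) *)
  have := cU _ _ (Itv01 l0 l1) (mem_set Ux) (mem_set Uy).
  rewrite inE; congr U; rewrite /conv/= !scalerA scalerDr /unstable.onem.
  by congr (_ *: _ + _ *: _); field; rewrite !gt_eqF.
- move=> l x r l0 [r0 Ux]; split; first exact: mulr_gt0.
  by rewrite scalerA invfM mulrAC mulVf ?gt_eqF// mul1r.
Qed.

(** If [z / r] were in [U] for some [r < 1], then so would be [z], between
    [z / r] and [0]. *)
Lemma gauge_ge1 {U} z : nbhs 0 U -> convex_set U -> ~ U z ->
  1 <= inf (gauge_epigraph U z).
Proof.
move=> U0 cU Uz; have [E0 _ _ _] := gauge_epigraph_cone U0 cU.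
apply: lb_le_inf => // r [r0 Ur]; rewrite leNgt; apply/negP => r1; apply: Uz.
have := cU _ _ (Itv01 (ltW r0) (ltW r1)) (mem_set Ur)
  (mem_set (nbhs_singleton U0)).
by rewrite inE /conv/= scaler0 addr0 scalerA divff ?gt_eqF// scale1r.
Qed.

(** By linearity [f <= e] on [e *: U] and [f >= - e] on [- e *: U], and both
    sets are neighbourhoods of [0]. *)
Lemma linear_bounded_above_continuous (f : {scalar X}) U : nbhs 0 U ->
  (forall x, U x -> f x <= 1) -> continuous (f : X -> R).
Proof.
move=> U0 fU x; apply/cvgrPdist_le => e e0.
have affine (c : R) : (c *: (y - x) @[y --> x]) --> (0 : X).
  rewrite -[X in _ --> X](scaler0 X c) -(subrr x).
  have sub0 : (y - x @[y --> x]) --> (x - x : X).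
    apply: (@continuous2_cvg X X X X _ _ id (fun=> x) (fun a b => a - b)).
    - exact: (@sub_continuous X (x, x)).
    - exact: cvg_id.
    - exact: cvg_cst.
  apply: (@continuous2_cvg X R^o X X _ _ (fun=> c) _ (fun a b => a *: b)).
  - exact: (@scale_continuous R X (c, x - x)).
  - exact: cvg_cst.
  - exact: sub0.
near=> y.
have /fU : U (e^-1 *: (y - x)) by near: y; exact: affine.
have /fU : U ((- e^-1) *: (y - x)) by near: y; exact: affine.
rewrite !linearZ/= linearB/= mulNr lerNl !ler_pdivlMl ?ler_pdivrMl// => h1 h2.
by rewrite distrC ler_norml -lerNl; lra.
Unshelve. all: by end_near. Qed.

Lemma exists_dual_lincomb (y w : topological_dual X) (t : R) :
  exists y' : topological_dual X,
    forall x, pairing x y' = pairing x y + t * pairing x w.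
Proof.
pose g (x : X) : R := pairing x y + t * pairing x w.
have glin : GRing.linear_for *%R g.
  move=> l u v; rewrite /g /pairing !linearP/=; ring.
have gc : continuous g.
  have pc (v : topological_dual X) : continuous (fun x => pairing x v).
    exact: dual_continuous.
  by move=> x; apply: cvgD; [exact: pc|apply: cvgMl_tmp; exact: pc].
pose f : {scalar X} := HB.pack g (GRing.isLinear.Build R X R^o _ g glin).
by exists (@TopologicalDual R X f gc).
Qed.

(** A convex neighbourhood [U] of [0] missing [- z] has a gauge at least [1] at
    [- z]; a functional below the gauge and equal to it at [- z] is
    continuous, being at most [1] on [U], and negative at [z]. *)
Lemma exists_dual_eqN1 z : hausdorff_space X -> z != 0 ->
  exists y : topological_dual X, pairing z y = -1.
Proof.
move=> hX z0; have Nz0 : 0 != - z by rewrite eq_sym oppr_eq0.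
have [V [oV /set_mem V0 /set_mem Vz]] := hausdorff_accessible hX Nz0.
have [B cB [Bo Bbasis]] := @locally_convex R X.
have [U [BU U0] UV] := Bbasis 0 V (open_nbhs_nbhs (conj oV V0)).
have nU : nbhs 0 U by apply: open_nbhs_nbhs; split=> //; exact: Bo.
have cU : convex_set U by exact/cB/mem_set.
have [f [fp fz]] := hahn_banach (- z) (sublinear_inf (gauge_epigraph_cone nU cU)).
have fU x : U x -> f x <= 1.
  move=> Ux; apply: le_trans (fp x) _; apply: ge_inf.
    exact: epigraph_cone_has_lbound (gauge_epigraph_cone nU cU) x.
  by split; rewrite ?invr1 ?scale1r.
pose y := TopologicalDual (linear_bounded_above_continuous f U nU fU).
have yz : 1 <= - pairing z y.
  by rewrite /pairing/= -linearN fz; apply: gauge_ge1 => // /UV.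
(* the coefficient makes 1 + t equal to - 1 / y z *)
have [w wE] := exists_dual_lincomb y y (- (pairing z y)^-1 - 1).
exists w; rewrite wE mulrBl mulNr mulVf; first ring.
by apply/eqP => y0; move: yz; rewrite y0; lra.
Qed.

(** Take [y] with value [-1] at [v].  If [c], its value at [u], is nonnegative,
    then [y] vanishes at [u + c *: v], which is nonzero by hypothesis.  A
    functional [w] negative at that vector can be corrected by a multiple of
    [y], without changing its value there, so as to be only slightly negative
    at [v]; this makes it negative at [u] as well. *)
Lemma exists_dual_lt0_pair u v : hausdorff_space X -> v != 0 ->
    (forall c : R, 0 <= c -> u != - (c *: v)) ->
  exists y : topological_dual X, pairing u y < 0 /\ pairing v y < 0.
Proof.
move=> hX v0 uv; have [y yv] := exists_dual_eqN1 v hX v0.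
have [yu|yu] := ltP (pairing u y) 0; first by exists y; rewrite yv; split; lra.
set c := pairing u y in yu.
have z0 : u + c *: v != 0 by rewrite addr_eq0; exact: uv.
have [w] := exists_dual_eqN1 _ hX z0.
rewrite {1}/pairing linearD linearZ/= -!/(pairing _ w) => wz.
(* the correction gives y' the value - 1 / (1 + c) at v; since y' is - 1 at
   u + c *: v, its value at u is also - 1 / (1 + c) *)
have [y' y'E] := exists_dual_lincomb w y (pairing v w + (1 + c)^-1).
have c1 : 0 < (1 + c)^-1 by rewrite invr_gt0; lra.
exists y'; rewrite !y'E yv -/c; split; last lra.
have : (1 + c) * (1 + c)^-1 = 1 by rewrite divff// gt_eqF//; lra.
nra.
Qed.

(** A nonnegative multiple of [- v] belongs to [C], hence differs from [u]. *)
Lemma exists_dual_lt0_cone_pair C u v : hausdorff_space X -> pointed_cone C ->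
    ~ C u -> C (- v) -> v != 0 ->
  exists y : topological_dual X, pairing u y < 0 /\ pairing v y < 0.
Proof.
move=> hX [[_ CZ] C0] Cu Cv v0; apply: exists_dual_lt0_pair => // c.
rewrite le_eqVlt => /predU1P[<-|c0]; apply/eqP => uE; apply: Cu; rewrite uE.
  by rewrite scale0r oppr0.
by rewrite -scalerN; exact: CZ.
Qed.

End point_separation.

(** * Represented cones *)

(** An analogue of the bipolar theorem for cones that need not be convex: one
    vector [z] outside [C] has to be separated from one [x] in [C] at a time,
    and this succeeds because [z] is not on the ray of [x]. *)
Lemma canonical_family_represents (R : realType) (X : tvsType R) (C : set X) :
  hausdorff_space X -> pointed_cone C -> C <> setT ->
  represents (canonical_family C) C.
Proof.
move=> hX hC Cproper; have [_ C0] := hC.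
have neq0 z : ~ C z -> z != 0 by move=> Cz; apply/eqP => zE; apply: Cz; rewrite zE.
split.
- have [z Cz] : exists z, ~ C z.
    by apply/existsNP => CT; apply: Cproper; rewrite eqEsubset; split.
  by exists (neg_halfspace z), z.
- move=> _ [z Cz <-]; have [y yz] := exists_dual_eqN1 z hX (neq0 z Cz).
  by exists y; rewrite /neg_halfspace/= yz ltrN10.
- rewrite eqEsubset; split=> [x Cx _ [z Cz <-]|x Kx].
    have [->|x0] := eqVneq x 0.
      have [y yz] := exists_dual_eqN1 z hX (neq0 z Cz).
      by exists y; rewrite /neg_halfspace/= yz ltrN10 /pairing linear0.
    have [||y [yz yx]] := exists_dual_lt0_cone_pair _ z (- x) hX hC Cz.
    + by rewrite opprK.
    + by rewrite oppr_eq0.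
    exists y; split=> //; move: yx; rewrite /pairing linearN oppr_lt0.
    exact: ltW.
  apply: contrapT => Cx; have [|y []] := Kx (neg_halfspace x); first by exists x.
  by rewrite /neg_halfspace/= => yx; rewrite leNgt yx.
Qed.

Theorem theorem3p1 (R : realType) (X : tvsType R) (hX : hausdorff_space X)
    (C : set X) (hC : pointed_cone C) (Cproper : C <> setT) :
  [<-> C `|` [set - x | x in C] = setT;
       pairwise_meeting (canonical_family C);
       exists F : set (set (topological_dual X)), represents F C /\ pairwise_meeting F].
Proof.
have [_ C0] := hC; tfae.
- move=> CT _ _ [u Cu <-] [v Cv <-].
  have CNv : C (- v).
    have : (C `|` [set - x | x in C]) v by rewrite CT.
    by case=> // -[x Cx <-]; rewrite opprK.
  have v0 : v != 0 by apply/eqP => vE; apply: Cv; rewrite vE.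
  have [y [yu yv]] := exists_dual_lt0_cone_pair _ _ _ hX hC Cu CNv v0.
  by exists y.
- by move=> meet; exists (canonical_family C); split=> //;
    exact: canonical_family_represents.
- move=> [F [[_ _ CF] meet]]; rewrite eqEsubset; split=> // x _.
  apply: contrapT => /not_orP[Cx CNx].
  have negK z : ~ C z -> exists2 K, F K & forall y, K y -> pairing z y < 0.
    rewrite CF => /existsNP[K /not_implyP[FK Kz]]; exists K => // y Ky.
    by rewrite ltNge; apply/negP => yz; apply: Kz; exists y.
  have [K FK Kx] := negK x Cx.
  have [|H FH Hx] := negK (- x).
    by move=> CN; apply: CNx; exists (- x); rewrite ?opprK.
  have [y [/Hx + /Kx]] := meet H K FH FK.
  by rewrite /pairing linearN oppr_lt0 => /lt_trans h /h; rewrite ltxx.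
Qed.
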